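(* Let $\mathcal C\le\mathbb F_q^{n\times m}$ be a rank-metric code of dimension $k$ with associated $(q,m)$-polymatroid $P_{\mathcal C}$. For all integers $1\le t\le r\le k$, $$W^{(r)}_{\mathcal C}(x,y)=\frac{1}{g_r(q^r,1)}\sum_{i=0}^{r}(-1)^{r-i}q^{\binom{r-i}{2}+i(t-1)}\begin{bmatrix}r\\ i\end{bmatrix}_q S_{P_{\mathcal C}^{(t-1)}}(q^i,x,y)$$ $$=\frac{1}{g_r(q^r,1)}\sum_{i=0}^{r}(-1)^{r-i}q^{\binom{r-i}{2}+i(t-1)}\begin{bmatrix}r\\ i\end{bmatrix}_q y^{\,n-\frac{k-t+1}{m}}R_{P_{\mathcal C}^{(t-1)}}\bigl(q^iy^{1/m},y^{-1/m},x,y\bigr).$$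
   Context: $q$ prime power, $E=\mathbb F_q^n$, $\mathcal L(E)$ its subspaces, $J^\perp$ orthogonal complement for the standard dot product. A rank-metric code is an $\mathbb F_q$-subspace $\mathcal C\le\mathbb F_q^{n\times m}$; $\mathrm{supp}(M)$ is the column space; for a subcode $\mathcal D$, $\mathrm{wt}(\mathcal D)=\dim\sum_{M\in\mathcal D}\mathrm{supp}(M)$; $W^{(r)}_{\mathcal C}(x,y)=\sum_{\mathcal D\le\mathcal C,\dim\mathcal D=r}x^{n-\mathrm{wt}(\mathcal D)}y^{\mathrm{wt}(\mathcal D)}$. $\mathcal C(J)=\{M\in\mathcal C\mid\mathrm{supp}(M)\subseteq J\}$, $\rho_{\mathcal C}(J)=\dim\mathcal C-\dim\mathcal C(J^\perp)$, $P_{\mathcal C}=(E,\rho_{\mathcal C})$ (a $(q,m)$-polymatroid, i.e. $\rho:\mathcal L(E)\to\mathbb Z_{\ge0}$ with $0\le\rho(A)\le m\dim A$, monotone, submodular). For a $(q,m)$-polymatroid $P=(E,\rho)$ and $0\le t\le\rho(E)$, the truncation $P^{(t)}=(E,\rho^{(t)})$ has $\rho^{(t)}(J)=\min\{\rho(J),\rho(E)-t\}$. $g_\ell(X,Y)=\prod_{i=0}^{\ell-1}(X-q^iY)$. $S_P(u,x,y)=\sum_{U\le E}u^{\rho(E)-\rho(U)}y^{n-\dim U}g_{\dim U}(x,y)$. The rank generating function is $R_P(X_1,X_2,X_3,X_4)=\sum_{A\le E}X_1^{\rho(E)-\rho(A)}X_2^{m\dim A-\rho(A)}g_{\dim A}(X_3,X_4)$;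 the second expression is interpreted with fractional powers of $y$. Gaussian coefficient $\begin{bmatrix}a\\ b\end{bmatrix}_q=\prod_{i=0}^{b-1}\frac{q^{a-i}-1}{q^{b-i}-1}$. *)

(* Defs.v *)
From HB Require Import structures.
From mathcomp Require Import all_boot all_order all_algebra zify.

Set Implicit Arguments.
Unset Strict Implicit.
Unset Printing Implicit Defensive.

Import GRing.Theory.

Local Open Scope ring_scope.

HB.instance Definition _ (F : finFieldType) (vT : vectType F) :=
  CanIsCountable (@VectorInternalTheory.vs2mxK F vT).
HB.instance Definition _ (F : finFieldType) (vT : vectType F) :
    isFinite {vspace vT} := CanIsFinite (@VectorInternalTheory.vs2mxK F vT).

Section Subspaces.

Variables (F : finFieldType) (n m : nat).
Implicit Types (J A B : {vspace 'cV[F]_n}) (C : {vspace 'M[F]_(n, m)}).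
Implicit Types M : 'M[F]_(n, m).

Definition dotv (u v : 'cV[F]_n) : F := \sum_(i < n) u i 0 * v i 0.

(* The set of vectors being spanned is already a subspace: see mem_orthv. *)
Definition orthv J : {vspace 'cV[F]_n} :=
  <<[seq v <- enum 'cV[F]_n | [forall u in J, dotv u v == 0%R]]>>%VS.

Definition supp M : {vspace 'cV[F]_n} := <<[seq col j M | j : 'I_m]>>%VS.

(* Likewise already a subspace: see mem_subcode. *)
Definition subcode C J : {vspace 'M[F]_(n, m)} :=
  <<[seq M <- enum 'M[F]_(n, m) | (M \in C) && (supp M <= J)%VS]>>%VS.

Definition wt (D : {vspace 'M[F]_(n, m)}) : nat :=
  \dim (\sum_(M in D) supp M)%VS.

End Subspaces.

Lemma mem_span_closed (F : finFieldType) (a b : nat) (P : pred 'M[F]_(a, b)) :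
    P 0 -> (forall c u v, P u -> P v -> P (c *: u + v)) ->
  forall v, (v \in <<[seq u <- enum 'M[F]_(a, b) | P u]>>%VS) = P v.
Proof.
move=> P0 PD v; apply/idP/idP => [|Pv]; last first.
  by apply: memv_span; rewrite mem_filter Pv mem_enum.
set s := filter _ _ => /(@coord_span _ _ _ (in_tuple s)) ->.
apply: (big_ind P) => // [x y Px Py|i _]; first by rewrite -[x]scale1r PD.
rewrite -[X in P X]addr0; apply: PD => //.
by have := mem_nth 0 (ltn_ord i); rewrite mem_filter => /andP[].
Qed.

Section SubspacesTheory.

Variables (F : finFieldType) (n m : nat).
Implicit Types (J A B : {vspace 'cV[F]_n}) (C : {vspace 'M[F]_(n, m)}).
Implicit Types M : 'M[F]_(n, m).

Lemma dotvDZr (u v w : 'cV[F]_n) c :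
  dotv u (c *: v + w) = c * dotv u v + dotv u w.
Proof.
rewrite /dotv mulr_sumr -big_split /=; apply: eq_bigr => i _.
by rewrite !mxE mulrDr mulrCA.
Qed.

Lemma dotvC (u v : 'cV[F]_n) : dotv u v = dotv v u.
Proof. by apply: eq_bigr => i _; rewrite mulrC. Qed.

Lemma mem_orthv J v : (v \in orthv J) = [forall u in J, dotv u v == 0].
Proof.
apply: (@mem_span_closed F n 1 (fun v => [forall u in J, dotv u v == 0])).
  apply/forall_inP => u _; apply/eqP; rewrite /dotv big1 // => i _.
  by rewrite mxE mulr0.
move=> c x y /forall_inP Px /forall_inP Py; apply/forall_inP => u Ju.
by rewrite dotvDZr (eqP (Px _ Ju)) (eqP (Py _ Ju)) mulr0 addr0.
Qed.

Lemma supp_subvP M J : reflect (forall j, col j M \in J) (supp M <= J)%VS.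
Proof.
apply: (iffP span_subvP) => [h j|h _ /imageP[j _ ->]] //.
by apply: h; apply/imageP; exists j.
Qed.

Lemma mem_subcode C J M :
  (M \in subcode C J) = (M \in C) && (supp M <= J)%VS.
Proof.
apply: (@mem_span_closed F n m (fun M => (M \in C) && (supp M <= J)%VS)).
  rewrite mem0v; apply/supp_subvP => j; rewrite col_const; exact: mem0v.
move=> c x y /andP[Cx /supp_subvP Jx] /andP[Cy /supp_subvP Jy].
apply/andP; split; first by rewrite memvD ?memvZ.
apply/supp_subvP => j; have -> : col j (c *: x + y) = c *: col j x + col j y.
  by apply/colP => i; rewrite !mxE.
by rewrite memvD ?memvZ.
Qed.

Lemma orthvS A B : (A <= B)%VS -> (orthv B <= orthv A)%VS.
Proof.
move=> /subvP AB; apply/subvP => v; rewrite !mem_orthv => /forall_inP h.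
by apply/forall_inP => u /AB; apply: h.
Qed.

Lemma subcodeS C A B : (A <= B)%VS -> (subcode C A <= subcode C B)%VS.
Proof.
move=> AB; apply/subvP => M; rewrite !mem_subcode => /andP[-> /= sA].
exact: subv_trans AB.
Qed.

Lemma subcode_sub C J : (subcode C J <= C)%VS.
Proof. by apply/subvP => M; rewrite mem_subcode => /andP[]. Qed.

Lemma orthvD A B : orthv (A + B) = (orthv A :&: orthv B)%VS.
Proof.
apply/vspaceP => v; rewrite memv_cap !mem_orthv.
apply/forall_inP/andP => [h|[/forall_inP hA /forall_inP hB]].
  split; apply/forall_inP => u uA; apply: h.
    exact: (subvP (addvSl A B)).
  exact: (subvP (addvSr A B)).
move=> _ /memv_addP[a Aa [b Bb ->]].
by rewrite dotvC -[a]scale1r dotvDZr ![dotv v _]dotvC (eqP (hA _ Aa))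
           (eqP (hB _ Bb)) mulr0 addr0.
Qed.

Lemma subcodeI C A B : subcode C (A :&: B) = (subcode C A :&: subcode C B)%VS.
Proof.
by apply/vspaceP => M; rewrite memv_cap !mem_subcode subv_cap andbACA andbb.
Qed.

Lemma dim_subcode_orth C J : (\dim C <= \dim (subcode C (orthv J)) + m * \dim J)%N.
Proof.
pose B : 'M[F]_(\dim J, n) := \matrix_(i, j) (vbasis J)`_i j 0.
pose phi := linfun (mulmx B : 'M[F]_(n, m) -> 'M[F]_(\dim J, m)).
rewrite -(limg_ker_dim phi C); apply: leq_add.
  apply/dimvS/subvP => M; rewrite memv_cap mem_subcode memv_ker lfunE /=.
  case/andP=> -> /= /eqP BM0; apply/supp_subvP => j.
  rewrite mem_orthv; apply/forall_inP => u uJ.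
  rewrite (coord_vbasis uJ) dotvC; apply/eqP.
  apply: (big_ind (fun w => dotv (col j M) w = 0)).
  - by rewrite /dotv big1 // => i _; rewrite [X in _ * X]mxE mulr0.
  - by move=> a b ha hb; rewrite -[a]scale1r dotvDZr ha hb mulr0 addr0.
  move=> i _; rewrite -[_ *: _]addr0 dotvDZr.
  have -> : dotv (col j M) 0 = 0.
    by rewrite /dotv big1 // => l _; rewrite [X in _ * X]mxE mulr0.
  rewrite addr0; apply/eqP; rewrite mulf_eq0; apply/orP; right; apply/eqP.
  have := congr1 (fun N : 'M[F]_(_, _) => N i j) BM0; rewrite !mxE => <-.
  by apply: eq_bigr => l _; rewrite !mxE mulrC.
apply: leq_trans (dimvS (subvf _)) _.
by rewrite dimvf /dim /= mulnC.
Qed.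

End SubspacesTheory.

Record qpolymatroid (F : finFieldType) (n m : nat) := QPolymatroid {
  qrank :> {vspace 'cV[F]_n} -> nat;
  qrank_le : forall A, (qrank A <= m * \dim A)%N;
  qrank_mono : forall A B, (A <= B)%VS -> (qrank A <= qrank B)%N;
  qrank_submod : forall A B,
    (qrank (A + B)%VS + qrank (A :&: B)%VS <= qrank A + qrank B)%N }.

Section CodePolymatroid.

Variables (F : finFieldType) (n m : nat) (C : {vspace 'M[F]_(n, m)}).
Implicit Types A B : {vspace 'cV[F]_n}.

Definition code_rank (J : {vspace 'cV[F]_n}) : nat :=
  (\dim C - \dim (subcode C (orthv J)))%N.

Lemma code_rank_le A : (code_rank A <= m * \dim A)%N.
Proof. by rewrite leq_subLR dim_subcode_orth. Qed.

Lemma code_rank_mono A B : (A <= B)%VS -> (code_rank A <= code_rank B)%N.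
Proof. by move=> AB; apply/leq_sub2l/dimvS/subcodeS/orthvS. Qed.

Lemma code_rank_submod A B :
  (code_rank (A + B)%VS + code_rank (A :&: B)%VS
     <= code_rank A + code_rank B)%N.
Proof.
rewrite /code_rank orthvD subcodeI.
set SA := subcode C (orthv A); set SB := subcode C (orthv B).
have h1 := dimv_sum_cap SA SB.
have h2 : (\dim (SA + SB) <= \dim (subcode C (orthv (A :&: B))))%N.
  by apply/dimvS; rewrite subv_add !subcodeS // orthvS // ?capvSl ?capvSr.
have h3 := dimvS (subcode_sub C (orthv A)).
have h4 := dimvS (subcode_sub C (orthv B)).
have h5 := dimvS (subcode_sub C (orthv (A :&: B))).
have h6 := dimvS (capvSl SA SB).
by rewrite -/SA in h3; rewrite -/SB in h4; lia.
Qed.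

Definition code_polymatroid : qpolymatroid F n m :=
  QPolymatroid code_rank_le code_rank_mono code_rank_submod.

End CodePolymatroid.

Section Truncation.

Variables (F : finFieldType) (n m : nat) (P : qpolymatroid F n m) (t : nat).
Implicit Types A B : {vspace 'cV[F]_n}.

(* Only meant for t <= P fullv; beyond that it is the zero rank function. *)
Definition trunc_rank (J : {vspace 'cV[F]_n}) : nat :=
  minn (P J) (P fullv - t)%N.

Lemma trunc_rank_le A : (trunc_rank A <= m * \dim A)%N.
Proof. exact: leq_trans (geq_minl _ _) (qrank_le P A). Qed.

Lemma trunc_rank_mono A B : (A <= B)%VS -> (trunc_rank A <= trunc_rank B)%N.
Proof. by move=> /(qrank_mono P) AB; rewrite /trunc_rank; lia. Qed.

Lemma trunc_rank_submod A B :
  (trunc_rank (A + B)%VS + trunc_rank (A :&: B)%VS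
     <= trunc_rank A + trunc_rank B)%N.
Proof.
have h := qrank_submod P A B.
have h1 := qrank_mono P (addvSl A B).
have h2 := qrank_mono P (addvSr A B).
have h3 := qrank_mono P (capvSl A B).
have h4 := qrank_mono P (capvSr A B).
by rewrite /trunc_rank; lia.
Qed.

Definition truncation : qpolymatroid F n m :=
  QPolymatroid trunc_rank_le trunc_rank_mono trunc_rank_submod.

End Truncation.

(* The polynomials below are given by their values at arbitrary elements of a *)
(* commutative ring. The natural-number subtractions in the exponents of       *)
(* weight_enum, Spoly and rank_gen are exact: wt D and \dim U are at most n,   *)
(* P U <= P fullv by qrank_mono, and P A <= m * \dim A by qrank_le.            *)

Definition gpoly (K : comNzRingType) (q l : nat) (X Y : K) : K :=
  \prod_(i < l) (X - q%:R ^+ i * Y).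

Definition gauss_coef (K : fieldType) (q a b : nat) : K :=
  \prod_(i < b) ((q%:R ^+ (a - i) - 1) / (q%:R ^+ (b - i) - 1)).

Definition weight_enum (F : finFieldType) (n m : nat)
    (C : {vspace 'M[F]_(n, m)}) (r : nat) (K : comNzRingType) (x y : K) : K :=
  \sum_(D : {vspace 'M[F]_(n, m)} | (D <= C)%VS && (\dim D == r))
    x ^+ (n - wt D) * y ^+ wt D.

Definition Spoly (F : finFieldType) (n m : nat) (P : qpolymatroid F n m)
    (K : comNzRingType) (u x y : K) : K :=
  \sum_(U : {vspace 'cV[F]_n})
    u ^+ (P fullv - P U) * y ^+ (n - \dim U) * gpoly #|F| (\dim U) x y.

Definition rank_gen (F : finFieldType) (n m : nat) (P : qpolymatroid F n m)
    (K : comNzRingType) (X1 X2 X3 X4 : K) : K :=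
  \sum_(A : {vspace 'cV[F]_n})
    X1 ^+ (P fullv - P A) * X2 ^+ (m * \dim A - P A) * gpoly #|F| (\dim A) X3 X4.

(* Main.v *)
(* If a subspace U has d = dim C(U^perp), the exponent of u in its summand of
   S_{P^(s)}(u, x, y), with s = t - 1, is max(d, s) - s. Weighted by q^(is), the
   alternating sum over i turns (q^i)^max(d, s) into g_r(q^max(d, s), 1) by the
   q-binomial theorem. Because s < r, this equals g_r(q^d, 1): both vanish when
   d <= s. That is the number of linearly independent r-tuples in C(U^perp), so
   dividing by g_r(q^r, 1) counts its r-dimensional subspaces D. Now
   D <= C(U^perp) iff D <= C and U <= V, where V = supp(D)^perp has dimension
   v = n - wt(D); exchanging sums, each D is weighted by
   y^wt(D) * sum_{U <= V} y^(v - dim U) g_{dim U}(x, y) = y^wt(D) x^v. *)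

Require Import Defs.
From mathcomp Require Import all_boot all_order all_algebra all_field zify ring.

Import GRing.Theory.
Local Open Scope ring_scope.

(** * Identities for [gpoly] and Gaussian coefficients *)

Lemma gpolyS (K : comNzRingType) q l (X Y : K) :
  gpoly q l.+1 X Y = gpoly q l X Y * (X - q%:R ^+ l * Y).
Proof. by rewrite /gpoly big_ord_recr. Qed.

Lemma gpoly_exp_eq0 (K : comNzRingType) q l d :
  (d < l)%N -> gpoly q l (q%:R ^+ d : K) 1 = 0.
Proof.
by move=> dl; rewrite /gpoly (bigD1 (Ordinal dl)) //= mulr1 subrr mul0r.
Qed.

Section GaussCoef.

Variables (K : fieldType) (q : nat).
Hypothesis q_neq0 : q%:R != 0 :> K.
Hypothesis q_nonroot : forall l, (0 < l)%N -> q%:R ^+ l != 1 :> K.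

Let Q : K := q%:R.

(** The factor of index 0 is split off; every later factor is [Q] times a factor of
    [gpoly q b (Q ^+ a) 1]. *)
Lemma gpolyS_exp a b :
  gpoly q b.+1 (Q ^+ a.+1) 1 = (Q ^+ a.+1 - 1) * Q ^+ b * gpoly q b (Q ^+ a) 1.
Proof.
rewrite /gpoly big_ord_recl /= expr0 mul1r -mulrA; congr (_ * _).
have -> : Q ^+ b = \prod_(i < b) Q by rewrite prodr_const card_ord.
by rewrite -big_split; apply: eq_bigr => i _; rewrite /bump /= !exprS; ring.
Qed.

Lemma gpoly_exp_neq0 b : gpoly q b (Q ^+ b) 1 != 0.
Proof.
elim: b => [|b IHb]; first by rewrite /gpoly big_ord0 oner_neq0.
by rewrite gpolyS_exp !mulf_neq0 // ?expf_neq0 // subr_eq0 q_nonroot.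
Qed.

Lemma gauss_coefE a b :
  gauss_coef K q a b = gpoly q b (Q ^+ a) 1 / gpoly q b (Q ^+ b) 1.
Proof.
have [ltab|leba] := ltnP a b.
  (* When [a < b], the factor of index [a] is zero on both sides. *)
  rewrite gpoly_exp_eq0 // mul0r /gauss_coef (bigD1 (Ordinal ltab)) //=.
  by rewrite subnn expr0 subrr !mul0r.
rewrite /gauss_coef /gpoly -prodf_div; apply: eq_bigr => i _.
have splitE c : (i <= c)%N -> Q ^+ c - Q ^+ i * 1 = Q ^+ i * (Q ^+ (c - i) - 1).
  by move=> ic; rewrite mulrBr -exprD subnKC.
rewrite !splitE ?(leq_trans (ltnW (ltn_ord i))) //.
rewrite invfM mulrACA divff ?mul1r // expf_neq0 //.
Qed.

Lemma gauss_coefn0 a : gauss_coef K q a 0 = 1.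
Proof. by rewrite /gauss_coef big_ord0. Qed.

Lemma gauss_coef_small a b : (a < b)%N -> gauss_coef K q a b = 0.
Proof. by move=> ab; rewrite gauss_coefE gpoly_exp_eq0 ?mul0r. Qed.

Lemma gauss_coefS a b :
  gauss_coef K q a.+1 b.+1 =
  gauss_coef K q a b + Q ^+ b.+1 * gauss_coef K q a b.+1.
Proof.
rewrite !gauss_coefE !gpolyS_exp gpolyS mulr1 -/Q.
have := gpoly_exp_neq0 b; have := q_nonroot b.+1 isT; rewrite -/Q -subr_eq0.
have := expf_neq0 b q_neq0; rewrite -/Q !exprS.
move: (Q ^+ a) (Q ^+ b) => A B B0 b0 g0.
by field; rewrite B0 b0 g0.
Qed.

(** The q-Pascal rule applied under a sum: the common induction step of the next two identities. *)
Lemma sum_gauss_coefS (f : nat -> K) n :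
  \sum_(j < n.+2) gauss_coef K q n.+1 j * f j =
  \sum_(j < n.+1) gauss_coef K q n j * (f j.+1 + Q ^+ j * f j).
Proof.
under [RHS]eq_bigr => j _ do rewrite mulrDr.
rewrite big_split /= big_ord_recl /= gauss_coefn0.
under [X in _ + X = _]eq_bigr => j _ do rewrite /bump /= gauss_coefS mulrDl.
rewrite big_split /= addrCA; congr (_ + _).
rewrite [in RHS]big_ord_recl big_ord_recr /= gauss_coef_small //.
rewrite gauss_coefn0 mulr0 mul0r addr0 expr0 !mul1r; congr (_ + _).
by apply: eq_bigr => j _; rewrite /bump mulrCA mulrA.
Qed.

(** The q-binomial theorem. *)
Lemma qbinomial_gpoly n (X : K) :
  \sum_(i < n.+1)
    (-1) ^+ (n - i) * Q ^+ 'C(n - i, 2) * gauss_coef K q n i * X ^+ i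
  = gpoly q n X 1.
Proof.
elim: n => [|n IHn].
  by rewrite big_ord1 gauss_coefn0 /gpoly big_ord0 !expr0 !mulr1.
rewrite gpolyS -IHn mulr_suml.
under [LHS]eq_bigr => i _ do rewrite mulrAC mulrC.
rewrite (sum_gauss_coefS
  (fun i => (-1) ^+ (n.+1 - i) * Q ^+ 'C(n.+1 - i, 2) * X ^+ i)).
apply: eq_bigr => i _ /=.
have le_in : (i <= n)%N by rewrite -ltnS.
(* As ['C(n.+1 - i, 2)] is ['C(n - i, 2) + (n - i)], the two shifted terms combine into the factor
   [X - Q ^+ n]. *)
rewrite subSS subSn // binS bin1 exprD !exprS.
have -> : q%:R ^+ n = Q ^+ (n - i) * Q ^+ i by rewrite -exprD subnK.
by ring.
Qed.

(** In the induction step, [gpoly q j.+1 x y + Q ^+ j * y * gpoly q j x y] collapses to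
    [x * gpoly q j x y]. *)
Lemma sum_gauss_gpoly n (x y : K) :
  \sum_(j < n.+1) gauss_coef K q n j * (y ^+ (n - j) * gpoly q j x y) = x ^+ n.
Proof.
elim: n => [|n IHn].
  by rewrite big_ord1 gauss_coefn0 /gpoly big_ord0 !expr0 !mulr1.
rewrite (sum_gauss_coefS (fun j => y ^+ (n.+1 - j) * gpoly q j x y)).
rewrite exprSr -IHn mulr_suml; apply: eq_bigr => j _.
have le_jn : (j <= n)%N by rewrite -ltnS.
by rewrite subSS subSn // gpolyS !exprS -/Q; ring.
Qed.

End GaussCoef.

(** * Counting subspaces of a given dimension *)

Section CountSubspaces.

Variables (F : finFieldType) (a b : nat).
Implicit Types W D : {vspace 'M[F]_(a, b)}.

(** A free [r]-tuple in [W] extends by exactly the vectors of [W] outside its span, which has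
    [#|F| ^ r] elements. *)
Lemma sum_free_tuples (K : comNzRingType) W r :
  \sum_(s : r.-tuple 'M[F]_(a, b) | free s && (<<s>> <= W)%VS) 1
    = gpoly #|F| r (#|F|%:R ^+ \dim W) 1 :> K.
Proof.
elim: r => [|r IHr].
  rewrite /gpoly big_ord0 (eq_bigl predT) => [|s].
    by rewrite sumr_const card_tuple expn0.
  by rewrite tuple0 /= nil_free span_nil sub0v.
rewrite gpolyS -IHr mulr_suml.
(* A tuple of length [r.+1] is split into its tail [p.1] and its head [p.2], the added vector. *)
rewrite (reindex (fun p : r.-tuple 'M[F]_(a, b) * 'M[F]_(a, b) =>
                    cons_tuple p.2 p.1)) /=; last first.
  exists (fun s => (behead_tuple s, thead s)) => [[s v]|s] _ /=.
    by rewrite theadE; congr (_, _); apply/val_inj.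
  by case/tupleP: s => v s; apply/val_inj; rewrite /= theadE.
pose A (s : r.-tuple 'M[F]_(a, b)) := free s && (<<s>> <= W)%VS.
pose B (s : r.-tuple 'M[F]_(a, b)) v := (v \in W) && (v \notin <<s>>%VS).
rewrite (eq_bigl (fun p => A p.1 && B p.1 p.2)) => [|[s v]] /=; last first.
  rewrite free_cons span_cons subv_add -memvE /A /B.
  by do !case: (_ \in _); rewrite ?andbT ?andbF.
rewrite -(pair_big_dep A B (fun _ _ => 1)) /=.
apply: eq_bigr => s /andP[free_s sW]; rewrite mul1r mulr1.
have card1 (V : {vspace 'M[F]_(a, b)}) :
    \sum_(v in V) 1 = #|F|%:R ^+ \dim V :> K.
  by rewrite sumr_const card_vspace natrX.
rewrite -(card1 W) [in RHS](bigID (mem <<s>>%VS)) /=.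
rewrite [X in _ = X + _ - _](eq_bigl (mem <<s>>%VS)) => [|v] /=; last first.
  by rewrite andb_idl // => /(subvP sW).
by rewrite card1 (eqnP free_s) size_tuple addrAC subrr add0r.
Qed.

(** Free [r]-tuples in [W] are grouped by their span; each span [D] has
    [gpoly #|F| r (#|F|%:R ^+ r) 1] ordered bases. *)
Lemma sum_subspaces_dim (K : fieldType) W r :
  #|F|%:R != 0 :> K -> (forall l, (0 < l)%N -> #|F|%:R ^+ l != 1 :> K) ->
  \sum_(D : {vspace 'M[F]_(a, b)} | (D <= W)%VS && (\dim D == r)) 1
    = gauss_coef K #|F| (\dim W) r :> K.
Proof.
move=> q0 q1; have g0 := @gpoly_exp_neq0 K #|F| q0 q1 r.
rewrite gauss_coefE //; apply: (mulIf g0); rewrite divfK //.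
rewrite -[RHS]sum_free_tuples mulr_suml.
rewrite (partition_big (fun s : r.-tuple 'M[F]_(a, b) => <<s>>%VS)
           (fun D => (D <= W)%VS && (\dim D == r))) /=; last first.
  by move=> s /andP[fs ->]; rewrite (eqnP fs) size_tuple eqxx.
apply: eq_bigr => D /andP[DW /eqP dD]; rewrite mul1r.
rewrite -[in X in gpoly _ _ (X) _]dD -sum_free_tuples.
apply: eq_bigl => s; have [fs|] //= := boolP (free s).
apply/idP/andP => [sD|[_ /eqP <-]]; last exact: subvv.
split; first exact: subv_trans DW.
by rewrite eqEdim sD dD (eqnP fs) size_tuple leqnn.
Qed.

Lemma sum_subspaces_gpoly (K : fieldType) W (x y : K) :
  #|F|%:R != 0 :> K -> (forall l, (0 < l)%N -> #|F|%:R ^+ l != 1 :> K) ->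
  \sum_(D : {vspace 'M[F]_(a, b)} | (D <= W)%VS)
     y ^+ (\dim W - \dim D) * gpoly #|F| (\dim D) x y = x ^+ \dim W.
Proof.
move=> q0 q1; rewrite -(@sum_gauss_gpoly K #|F| q0 q1 (\dim W) x y).
(* The default value of [inord] never occurs, since [D <= W] bounds [\dim D] by [\dim W]. *)
rewrite (partition_big (fun D : {vspace 'M[F]_(a, b)} => inord (\dim D))
           (fun j : 'I_(\dim W).+1 => true)) //=.
apply: eq_bigr => j _; rewrite -sum_subspaces_dim // mulr_suml.
apply: eq_big => [D|D /andP[DW /eqP <-]].
  have [DW|] //= := boolP (D <= W)%VS.
  by rewrite -val_eqE /= inordK // ltnS dimvS.
by rewrite mul1r inordK // ltnS dimvS.
Qed.

End CountSubspaces.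

(** * Orthogonal complements and codimension in the truncation *)

Section Orthogonal.

Variables (F : finFieldType) (n m : nat).
Implicit Types A B : {vspace 'cV[F]_n}.

Lemma subv_orthvC A B : (A <= orthv B)%VS = (B <= orthv A)%VS.
Proof.
suff sub A' B' : (A' <= orthv B')%VS -> (B' <= orthv A')%VS.
  by apply/idP/idP; apply: sub.
move=> /subvP AB; apply/subvP => v vB; rewrite mem_orthv.
apply/forall_inP => u /AB; rewrite mem_orthv => /forall_inP/(_ v vB).
by rewrite dotvC.
Qed.

Lemma mem_orthv_line (u v : 'cV[F]_n) : (u \in orthv <[v]>) = (dotv v u == 0).
Proof.
rewrite mem_orthv; apply/forall_inP/idP => [|/eqP vu0 _ /vlineP[c ->]].
  by apply; apply: memv_line.
apply/eqP; rewrite -[RHS](mulr0 c) -[in RHS]vu0 /dotv mulr_sumr.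
by apply: eq_bigr => i _; rewrite mxE mulrA.
Qed.

(** Rank-nullity for the matrix [B] whose rows form a basis of [A]: its kernel is [orthv A], and
    full row rank makes it surjective. *)
Lemma dim_orthv A : \dim (orthv A) = (n - \dim A)%N.
Proof.
pose B : 'M[F]_(\dim A, n) := \matrix_(i, j) (vbasis A)`_i j 0.
have B_free : row_free B.
  apply: inj_row_free => w wB0; apply/rowP => i; rewrite mxE.
  have /freeP := basis_free (vbasisP A); apply.
  apply/colP => j; rewrite summxE mxE.
  transitivity ((w *m B) 0 j); last by rewrite wB0 mxE.
  by rewrite mxE; apply: eq_bigr => l _; rewrite !mxE.
pose phi := linfun (mulmx B : 'cV[F]_n -> 'cV[F]_(\dim A)).
have ker_phi : lker phi = orthv A.
  apply/vspaceP => v; rewrite memv_ker lfunE /=.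
  have rowE i : (B *m v) i 0 = dotv v (vbasis A)`_i.
    by rewrite mxE dotvC; apply: eq_bigr => l _; rewrite !mxE.
  rewrite memvE -[RHS]subv_orthvC.
  rewrite -[X in _ = (X <= _)%VS](span_basis (vbasisP A)).
  apply/eqP/span_subvP => [Bv0 u /(nthP 0)[i]|h].
    rewrite size_tuple => ltiA <-; rewrite mem_orthv_line.
    by rewrite -(rowE (Ordinal ltiA)) Bv0 mxE.
  apply/colP => i; rewrite rowE mxE; apply/eqP; rewrite -mem_orthv_line.
  by apply/h/mem_nth; rewrite size_tuple.
have img_phi : limg phi = fullv.
  apply/vspaceP => w; rewrite memvf; apply/memv_imgP.
  exists (pinvmx B *m w); rewrite ?memvf // lfunE /= mulmxA.
  by rewrite mulmxVp // mul1mx.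
have := limg_ker_dim phi fullv.
rewrite capfv ker_phi img_phi !dimvf /dim /= !muln1 => dimE.
by rewrite -[X in (X - _)%N]dimE addnK.
Qed.

Lemma orthv_full : orthv (fullv : {vspace 'cV[F]_n}) = 0%VS.
Proof. by apply/eqP; rewrite -dimv_eq0 dim_orthv dimvf /dim /= muln1 subnn. Qed.

Lemma subv_subcode_orthv (C D : {vspace 'M[F]_(n, m)}) A :
  (D <= subcode C (orthv A))%VS =
  (D <= C)%VS && (A <= orthv (\sum_(M in D) supp M))%VS.
Proof.
rewrite subv_orthvC; apply/subvP/andP => [DCA|[/subvP DC /subv_sumP DA] M MD].
  split; first by apply/subvP => M /DCA; rewrite mem_subcode => /andP[].
  by apply/subv_sumP => M /DCA; rewrite mem_subcode => /andP[].
by rewrite mem_subcode DC ?DA.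
Qed.

Lemma subcode0 (C : {vspace 'M[F]_(n, m)}) : subcode C 0 = 0%VS.
Proof.
apply/eqP; rewrite -subv0; apply/subvP => M.
rewrite mem_subcode memv0 => /andP[_ /supp_subvP M0]; apply/eqP/matrixP => i j.
by have := M0 j; rewrite memv0 => /eqP/colP/(_ i); rewrite !mxE.
Qed.

Lemma code_rank_full (C : {vspace 'M[F]_(n, m)}) : code_rank C fullv = \dim C.
Proof. by rewrite /code_rank orthv_full subcode0 dimv0 subn0. Qed.

(** With [d] the dimension of the subcode, the codimension is [(k - s) - min(k - d, k - s)]; adding
    [s] avoids a truncated subtraction. *)
Lemma trunc_code_rank_codim (C : {vspace 'M[F]_(n, m)}) s A :
  (s <= \dim C)%N ->
  let P := truncation (code_polymatroid C) s in
  (P fullv - P A + s = maxn (\dim (subcode C (orthv A))) s)%N.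
Proof.
move=> sC /=; rewrite /trunc_rank /= code_rank_full /code_rank.
by have := dimvS (subcode_sub C (orthv A)); lia.
Qed.

End Orthogonal.

(** * The weight enumerator as a sum over subspaces *)

Section WeightEnumerator.

Variables (F : finFieldType) (n m : nat) (C : {vspace 'M[F]_(n, m)}).
Variable K : fieldType.
Hypothesis charK : [pchar K] =i pred0.

Let q := #|F|.

(** In characteristic 0 the positive integers [q] and [q ^ l - 1] stay nonzero, as the Gaussian
    coefficient identities require. *)
Lemma card_field_neq0 : q%:R != 0 :> K.
Proof. by rewrite (pcharf0P K).1 // -lt0n ltnW // card_finNzRing_gt1. Qed.

Lemma card_field_nonroot l : (0 < l)%N -> q%:R ^+ l != 1 :> K.
Proof.
move=> l0; have q1 : (1 < q)%N := card_finNzRing_gt1 F.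
have ql1 : (1 < q ^ l)%N by rewrite -{1}(exp1n l) ltn_exp2r.
have : (q ^ l - 1)%:R != 0 :> K by rewrite (pcharf0P K).1 // subn_eq0 -ltnNge.
by rewrite natrB ?(ltnW ql1) // natrX mulr1n subr_eq0.
Qed.

Lemma weight_enum_subspaces r (x y : K) :
  weight_enum C r x y =
  \sum_(U : {vspace 'cV[F]_n})
    gauss_coef K q (\dim (subcode C (orthv U))) r *
    (y ^+ (n - \dim U) * gpoly q (\dim U) x y).
Proof.
have q0 := card_field_neq0; have q1 := card_field_nonroot.
under [RHS]eq_bigr => U _ do rewrite -sum_subspaces_dim // mulr_suml.
rewrite /weight_enum.
rewrite [RHS](exchange_big_dep (fun D => (D <= C)%VS && (\dim D == r))) /=.
  apply: eq_bigr => D /andP[DC /eqP dD].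
  set S := orthv (\sum_(M in D) supp M)%VS.
  have dS : \dim S = (n - wt D)%N by rewrite dim_orthv.
  have wtD : (wt D <= n)%N.
    by rewrite (leq_trans (dimvS (subvf _))) // dimvf /dim /= muln1.
  (* Column vectors are [n] by 1 matrices, so the counting lemmas for matrix spaces apply to [S]. *)
  rewrite -dS -(@sum_subspaces_gpoly F n 1 K S x y) // mulr_suml.
  apply: eq_big => [U|U US].
    by rewrite subv_subcode_orthv DC dD eqxx andbT.
  rewrite mul1r mulrAC -exprD; congr (_ ^+ _ * _).
  by have := dimvS US; rewrite dS; lia.
by move=> U D _ /andP[DU ->]; rewrite (subv_trans DU) ?subcode_sub.
Qed.

Lemma qbinomial_gauss_coef r s d e : (s < r)%N -> (e + s = maxn d s)%N ->
  (gpoly q r (q%:R ^+ r) 1)^-1 *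
  \sum_(i < r.+1) (-1) ^+ (r - i) * q%:R ^+ ('C(r - i, 2) + i * s) *
    gauss_coef K q r i * (q%:R ^+ i) ^+ e
  = gauss_coef K q d r.
Proof.
have q0 := card_field_neq0; have q1 := card_field_nonroot.
move=> sr esd.
have -> : gauss_coef K q d r = gauss_coef K q (maxn d s) r.
  by case: (leqP d s) => // ds; rewrite !gauss_coef_small // (leq_ltn_trans ds).
rewrite gauss_coefE // mulrC -qbinomial_gpoly //; congr (_ / _).
apply: eq_bigr => i _.
by rewrite -esd -!exprM mulnDl !exprD (mulnC s) (mulnC e); ring.
Qed.

Lemma weight_enum_truncation r s (x y : K) : (s < r)%N -> (r <= \dim C)%N ->
  weight_enum C r x y =
    (gpoly q r (q%:R ^+ r) 1)^-1 *
    \sum_(i < r.+1)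
      (-1) ^+ (r - i) * q%:R ^+ ('C(r - i, 2) + i * s) * gauss_coef K q r i *
      Spoly (truncation (code_polymatroid C) s) (q%:R ^+ i) x y.
Proof.
move=> sr rC; have sC := leq_trans (ltnW sr) rC.
rewrite weight_enum_subspaces /Spoly -/q.
under [X in _ = _ * X]eq_bigr => i _ do rewrite mulr_sumr.
rewrite exchange_big mulr_sumr; apply: eq_bigr => U _ /=.
have eU := trunc_code_rank_codim _ _ _ C s U sC.
rewrite -(qbinomial_gauss_coef _ _ _ _ sr eU).
rewrite -mulrA mulr_suml; congr (_ * _).
by apply: eq_bigr => i _; rewrite -/q !mulrA.
Qed.

End WeightEnumerator.

(** Summand by summand, both sides carry the same power of [z]: [m * (n - \dim A)] equals [m * n - P
    fullv + (P fullv - P A) - (m * \dim A - P A)]. *)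
Lemma Spoly_rank_gen (F : finFieldType) (n m : nat) (P : qpolymatroid F n m)
    (K : fieldType) (u x y z : K) : z != 0 -> z ^+ m = y ->
  Spoly P u x y = y ^+ n * z ^- P fullv * rank_gen P (u * z) z^-1 x y.
Proof.
move=> z0 zy; rewrite /Spoly /rank_gen mulr_sumr; apply: eq_bigr => A _.
have dA : (\dim A <= n)%N.
  by rewrite (leq_trans (dimvS (subvf _))) // dimvf /dim /= muln1.
have PA := qrank_mono P (subvf A); have PmA := qrank_le P A.
have -> : y ^+ (n - \dim A) = y ^+ n * z ^- P fullv *
    (z ^+ (P fullv - P A) * z^-1 ^+ (m * \dim A - P A)).
  rewrite exprVn mulrA; apply: (canRL (mulfK _)); first by rewrite expf_neq0.
  rewrite [RHS]mulrAC; apply: (canRL (mulfK _)); first by rewrite expf_neq0.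
  rewrite -zy -!exprM -!exprD; congr (_ ^+ _).
  by have := leq_mul (leqnn m) dA; rewrite mulnBr; lia.
by rewrite exprMn mulrCA !mulrA.
Qed.

(* z stands for y^(1/m), so that y^(n - (k-t+1)/m) = y^n * z^-(k-t+1).
   Taking K to be the field of rational functions over rat in x and z gives
   the identities between formal expressions. *)
Theorem theorem4p9 (F : finFieldType) (n m k t r : nat)
    (C : {vspace 'M[F]_(n, m)}) (hk : \dim C = k)
    (h1t : (1 <= t)%N) (htr : (t <= r)%N) (hrk : (r <= k)%N)
    (K : fieldType) (charK : [pchar K] =i pred0) (x y : K) :
  let q := #|F| in
  let P := truncation (code_polymatroid C) (t - 1) in
  weight_enum C r x y =
    (gpoly q r (q%:R ^+ r) 1)^-1 *
    \sum_(0 <= i < r.+1)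
      (-1) ^+ (r - i) * q%:R ^+ ('C(r - i, 2) + i * (t - 1)) *
      gauss_coef K q r i * Spoly P (q%:R ^+ i) x y
  /\
  (forall z : K, z != 0 -> z ^+ m = y ->
    weight_enum C r x y =
      (gpoly q r (q%:R ^+ r) 1)^-1 *
      \sum_(0 <= i < r.+1)
        (-1) ^+ (r - i) * q%:R ^+ ('C(r - i, 2) + i * (t - 1)) *
        gauss_coef K q r i * (y ^+ n * z ^- (k - t + 1)) *
        rank_gen P (q%:R ^+ i * z) z^-1 x y).
Proof.
move=> q P; subst k.
have sr : (t - 1 < r)%N by lia.
have S := weight_enum_truncation _ _ _ C _ charK r (t - 1) x y sr hrk.
rewrite big_mkord; split=> // z z0 zy; rewrite big_mkord S; congr (_ * _).
apply: eq_bigr => i _; rewrite (Spoly_rank_gen _ _ _ P _ _ _ _ _ z0 zy).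
rewrite !mulrA; congr (_ * _ / _ ^+ _ * _).
(* The total rank of the truncation is [k - (t - 1)], which is [k - t + 1] because [1 <= t <= k]. *)
by rewrite /= /trunc_rank /= code_rank_full; lia.
Qed.
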